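(* Let $A_1=[x_1,y_1]$, $A_2=[x_2,y_2]$, $A_3=[x_3,y_3]$ be three distinct non-collinear points of the plane over a field of characteristic not two. For $m=1,2,3$ let $a_m^b,a_m^r,a_m^g$ be respectively the blue, red and green altitudes from $A_m$ to the opposite line of the triangle. Then the three blue altitudes $a_1^b,a_2^b,a_3^b$ meet in a point $O_b$, the three red altitudes $a_1^r,a_2^r,a_3^r$ meet in a point $O_r$, and the three green altitudes $a_1^g,a_2^g,a_3^g$ meet in a point $O_g$, and these points are given by $$O_b=\left[\frac{[x_1x_2y_2]^-+[y_1y_2^2]^-}{[x_1y_2]^-},\ \frac{[x_1y_1y_2]^-+[x_1^2x_2]^-}{[x_1y_2]^-}\right],$$ $$O_r=\left[\frac{[x_1x_2y_2]^--[y_1y_2^2]^-}{[x_1y_2]^-},\ \frac{[x_1y_1y_2]^--[x_1^2x_2]^-}{[x_1y_2]^-}\right],$$ $$O_g=\left[\frac{[x_1^2y_2]^-+[x_1x_2y_1]^-}{[x_1y_2]^-},\ \frac{[x_1y_2^2]^--[x_1y_1y_2]^-}{[x_1y_2]^-}\right].$$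
   Context: Work over a fixed field not of characteristic two. A point is an ordered pair $[x,y]$ of field elements. A line is a proportion $\langle a:b:c\rangle$ with $a,b$ not both zero; the point $[x,y]$ lies on it precisely when $ax+by+c=0$. Lines $\langle a_1:b_1:c_1\rangle$ and $\langle a_2:b_2:c_2\rangle$ are blue perpendicular when $a_1a_2+b_1b_2=0$, red perpendicular when $a_1a_2-b_1b_2=0$, and green perpendicular when $a_1b_2+b_1a_2=0$. For each colour, the altitude of that colour from a point $A$ to a line $l$ is the unique line through $A$ which is perpendicular to $l$ in that colour. The opposite line to $A_1$ is $A_2A_3$, and so on. For a monomial $m$ in variables $x_i,y_i$ with indices in $\{1,2,3\}$, $[m]^-$ denotes the sum over all six permutations $\sigma$ of $\{1,2,3\}$ of $\operatorname{sgn}(\sigma)$ times the monomial obtained from $m$ by applying $\sigma$ to the indices; e.g. $[x_1y_2]^-=x_1y_2-x_1y_3+x_2y_3-x_3y_2+x_3y_1-x_2y_1$, which is nonzero when the points are non-collinear. *)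

(* Defs.v *)
From mathcomp Require Import all_boot all_algebra perm.
From mathcomp Require Import generic_quotient ring.

Set Implicit Arguments.
Unset Strict Implicit.
Unset Printing Implicit Defensive.

Import GRing.Theory.
Local Open Scope ring_scope.
Local Open Scope quotient_scope.

Definition point (F : fieldType) : Type := (F * F)%type.

Definition nonzero_normal (F : fieldType) (t : F * F * F) : bool :=
  (t.1.1 != 0) || (t.1.2 != 0).

Definition coefs (F : fieldType) : Type := {t : F * F * F | nonzero_normal t}.

Section Lines.
Variable F : fieldType.
Implicit Types (P : point F) (s t : coefs F).

Definition cfa t : F := (val t).1.1.
Definition cfb t : F := (val t).1.2.
Definition cfc t : F := (val t).2.

Lemma coefsP t : (cfa t != 0) || (cfb t != 0).
Proof. exact: valP t. Qed.

Definition scaled s t : Prop :=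
  exists2 k : F, k != 0 &
    [/\ cfa t = k * cfa s, cfb t = k * cfb s & cfc t = k * cfc s].

Definition proportional s t : bool :=
  [&& cfa s * cfb t == cfb s * cfa t,
      cfa s * cfc t == cfc s * cfa t & cfb s * cfc t == cfc s * cfb t].

Lemma proportionalP s t : reflect (scaled s t) (proportional s t).
Proof.
apply: (iffP and3P) => [[/eqP ab /eqP ac /eqP bc]|[k _ [-> -> ->]]]; last first.
  by split; apply/eqP; ring.
have [a0|a0] := eqVneq (cfa s) 0.
  have b0 : cfb s != 0 by have := coefsP s; rewrite a0 eqxx.
  have at0 : cfa t = 0.
    by apply: (mulfI b0); rewrite -ab a0 !mul0r mulr0.
  have bt0 : cfb t != 0 by have := coefsP t; rewrite at0 eqxx.
  exists (cfb t / cfb s); first by rewrite mulf_neq0 ?invr_eq0.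
  split; first by rewrite a0 mulr0.
    by rewrite divfK.
  by apply: (mulfI b0); rewrite bc; field.
have at0 : cfa t != 0.
  apply: contraTneq (coefsP t) => at0; rewrite at0 eqxx /= negbK.
  by apply/eqP/(mulfI a0); rewrite ab at0 !mulr0.
exists (cfa t / cfa s); first by rewrite mulf_neq0 ?invr_eq0.
split; first by rewrite divfK.
  by apply: (mulfI a0); rewrite ab; field.
by apply: (mulfI a0); rewrite ac; field.
Qed.

Lemma proportional_refl : reflexive proportional.
Proof. by move=> t; apply/proportionalP; exists 1; rewrite ?oner_eq0 ?mul1r. Qed.

Lemma proportional_sym : symmetric proportional.
Proof.
by move=> s t; rewrite /proportional ![cfa t * _]mulrC ![cfb t * _]mulrC
  ![cfc t * _]mulrC [cfb s * cfa t == _]eq_sym [cfc s * cfa t == _]eq_sym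
  [cfc s * cfb t == _]eq_sym.
Qed.

Lemma proportional_trans : transitive proportional.
Proof.
move=> t s u /proportionalP[k k0 [ta tb tc]] /proportionalP[h h0 [ua ub uc]].
apply/proportionalP; exists (h * k); first exact: mulf_neq0.
by rewrite ua ub uc ta tb tc !mulrA.
Qed.

Canonical proportional_equiv :=
  EquivRel proportional proportional_refl proportional_sym proportional_trans.

(* Lines are proportions: nonzero multiples of a triple (a, b, c) are identified,
   so that equality of lines is Leibniz equality. *)
Definition line : Type := {eq_quot proportional}.

Definition on_line P (l : line) : bool :=
  cfa (repr l) * P.1 + cfb (repr l) * P.2 + cfc (repr l) == 0.

Inductive colour := Blue | Red | Green.

Definition perpendicular (col : colour) (l1 l2 : line) : bool :=
  let: (a1, b1) := (cfa (repr l1), cfb (repr l1)) in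
  let: (a2, b2) := (cfa (repr l2), cfb (repr l2)) in
  match col with
  | Blue => a1 * a2 + b1 * b2 == 0
  | Red => a1 * a2 - b1 * b2 == 0
  | Green => a1 * b2 + b1 * a2 == 0
  end.

Lemma line_eqP s t : reflect (scaled s t) (\pi_line s == \pi_line t).
Proof. by rewrite (eqmodE proportional_equiv); exact: proportionalP. Qed.

Lemma repr_scaled t : scaled t (repr (\pi_line t)).
Proof. by apply/line_eqP; rewrite reprK. Qed.

Lemma on_lineE P t :
  on_line P (\pi_line t) = (cfa t * P.1 + cfb t * P.2 + cfc t == 0).
Proof.
rewrite /on_line; have [k k0 [-> -> ->]] := repr_scaled t.
by rewrite -!mulrA -!mulrDr mulf_eq0 (negPf k0).
Qed.

Lemma perpendicularE col s t :
  perpendicular col (\pi_line s) (\pi_line t) =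
  match col with
  | Blue => cfa s * cfa t + cfb s * cfb t == 0
  | Red => cfa s * cfa t - cfb s * cfb t == 0
  | Green => cfa s * cfb t + cfb s * cfa t == 0
  end.
Proof.
rewrite /perpendicular.
have [k k0 [-> -> _]] := repr_scaled s; have [h h0 [-> -> _]] := repr_scaled t.
have kh0 : k * h != 0 by exact: mulf_neq0.
by case: col; rewrite -[RHS](inj_eq (mulfI kh0)) mulr0; congr (_ == _); ring.
Qed.

Definition mk_line (a b c : F) (h : (a != 0) || (b != 0)) : line :=
  \pi_line (exist _ (a, b, c) h).

Lemma line_through_exists P Q : exists l : line, on_line P l && on_line Q l.
Proof.
have [h|] := boolP ((P.2 - Q.2 != 0) || (Q.1 - P.1 != 0)).
  exists (mk_line (P.1 * Q.2 - P.2 * Q.1) h).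
  by rewrite !on_lineE /cfa /cfb /cfc /=; apply/andP; split; apply/eqP; ring.
rewrite negb_or !negbK !subr_eq0 => /andP[/eqP e2 /eqP e1].
have h : ((1 : F) != 0) || ((0 : F) != 0) by rewrite oner_eq0.
exists (mk_line (- P.1) h).
by rewrite !on_lineE /cfa /cfb /cfc /= e1 !mul1r !mul0r !addr0 subrr eqxx.
Qed.

Lemma altitude_exists col P (l : line) :
  exists k : line, on_line P k && perpendicular col k l.
Proof.
rewrite -[l]reprK; move: (repr l) => t.
have [u [v [h uv]]] : exists u v, ((u != 0) || (v != 0)) /\
  match col with
  | Blue => u * cfa t + v * cfb t = 0
  | Red => u * cfa t - v * cfb t = 0
  | Green => u * cfb t + v * cfa t = 0
  end.
  have h := coefsP t; case: col.
  - by exists (cfb t), (- cfa t); rewrite oppr_eq0 orbC; split=> //; ring.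
  - by exists (cfb t), (cfa t); rewrite orbC; split=> //; ring.
  - by exists (cfa t), (- cfb t); rewrite oppr_eq0; split=> //; ring.
exists (mk_line (- (u * P.1 + v * P.2)) h).
rewrite on_lineE perpendicularE {1 2 3}/cfa {1 2 3}/cfb {1}/cfc /= subrr eqxx.
by case: col uv => ->; rewrite eqxx.
Qed.

(* The line through two points, unique as soon as they are distinct
   (see line_through_unique). *)
Definition line_through P Q : line := xchoose (line_through_exists P Q).

(* The unique line through P that is perpendicular to l (see altitude_unique). *)
Definition altitude (col : colour) P (l : line) : line :=
  xchoose (altitude_exists col P l).

Lemma line_throughP P Q :
  on_line P (line_through P Q) && on_line Q (line_through P Q).
Proof. exact: xchooseP (line_through_exists P Q). Qed.

Lemma altitudeP col P (l : line) :
  on_line P (altitude col P l) && perpendicular col (altitude col P l) l.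
Proof. exact: xchooseP (altitude_exists col P l). Qed.

(* Lines sharing a point whose normals are both orthogonal to (u, v) are equal. *)
Lemma line_eq_dir P (u v : F) (k l : line) :
  (u != 0) || (v != 0) -> on_line P k -> on_line P l ->
  cfa (repr k) * u + cfb (repr k) * v = 0 ->
  cfa (repr l) * u + cfb (repr l) * v = 0 -> k = l.
Proof.
rewrite /on_line => uv /eqP + /eqP.
suff : forall s t, cfa s * P.1 + cfb s * P.2 + cfc s = 0 ->
    cfa t * P.1 + cfb t * P.2 + cfc t = 0 ->
    cfa s * u + cfb s * v = 0 -> cfa t * u + cfb t * v = 0 ->
    \pi_line s = \pi_line t.
  by move=> H *; rewrite -[k]reprK -[l]reprK; exact: H.
move=> s t Ps Pt su tu {k l}.
have ab : cfa s * cfb t = cfb s * cfa t.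
  case/orP: uv => w0; apply: (mulfI w0); apply/eqP; rewrite -subr_eq0.
    have -> : u * (cfa s * cfb t) - u * (cfb s * cfa t) =
      (cfa s * u + cfb s * v) * cfb t - (cfa t * u + cfb t * v) * cfb s by ring.
    by rewrite su tu !mul0r subrr.
  have -> : v * (cfa s * cfb t) - v * (cfb s * cfa t) =
    (cfa t * u + cfb t * v) * cfa s - (cfa s * u + cfb s * v) * cfa t by ring.
  by rewrite su tu !mul0r subrr.
have es : cfc s = - (cfa s * P.1 + cfb s * P.2).
  by apply/eqP; rewrite -addr_eq0 addrC Ps.
have et : cfc t = - (cfa t * P.1 + cfb t * P.2).
  by apply/eqP; rewrite -addr_eq0 addrC Pt.
apply/eqP/line_eqP/proportionalP; rewrite /proportional ab eqxx es et /=.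
apply/andP; split; rewrite -subr_eq0; apply/eqP.
  transitivity (P.2 * (cfb s * cfa t - cfa s * cfb t)); first by ring.
  by rewrite ab subrr mulr0.
transitivity (P.1 * (cfa s * cfb t - cfb s * cfa t)); first by ring.
by rewrite ab subrr mulr0.
Qed.

Lemma line_through_unique P Q (l : line) :
  P != Q -> on_line P l && on_line Q l = (l == line_through P Q).
Proof.
move=> PQ; apply/andP/eqP => [[Pl Ql]|->]; last exact/andP/line_throughP.
have /andP[Pk Qk] := line_throughP P Q.
have dir (k : line) : on_line P k -> on_line Q k ->
    cfa (repr k) * (P.1 - Q.1) + cfb (repr k) * (P.2 - Q.2) = 0.
  move=> /eqP eP /eqP eQ; rewrite -[RHS](subrr 0) -{1}eP -eQ; ring.
apply: (@line_eq_dir P (P.1 - Q.1) (P.2 - Q.2)) => //; try exact: dir.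
rewrite -negb_and !subr_eq0; apply: contra PQ.
by case: P Q {Pl Ql Pk Qk dir} => [? ?] [? ?] /=.
Qed.

Lemma altitude_unique col P (k l : line) :
  on_line P k && perpendicular col k l = (k == altitude col P l).
Proof.
apply/andP/eqP => [[Pk kl]|->]; last exact/andP/altitudeP.
have /andP[Pa al] := altitudeP col P l.
have h := coefsP (repr l).
case: col kl al Pa => /eqP kl /eqP al Pa.
- exact: (@line_eq_dir P (cfa (repr l)) (cfb (repr l))).
- apply: (@line_eq_dir P (cfa (repr l)) (- cfb (repr l))) => //.
  + by rewrite oppr_eq0.
  + by rewrite mulrN.
  + by rewrite mulrN.
- by apply: (@line_eq_dir P (cfb (repr l)) (cfa (repr l))) => //; rewrite orbC.
Qed.

(* Indices in 'I_3 are 0, 1, 2, with addition modulo 3. *)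
Definition collinear (A : 'I_3 -> point F) : Prop :=
  exists l : line, forall i, on_line (A i) l.

Definition opposite (A : 'I_3 -> point F) (i : 'I_3) : line :=
  line_through (A (i + 1)) (A (i + 1 + 1)).

Definition triangle_altitude (col : colour) (A : 'I_3 -> point F) (i : 'I_3) :
  line := altitude col (A i) (opposite A i).

Definition meet_at (L : 'I_3 -> line) (O : point F) : Prop :=
  forall P, (forall i, on_line P (L i)) <-> P = O.

(* The bracket [m]^-: the monomial m is given as a function of its three indices,
   so that, e.g., [x_1 y_2]^- is antisym (fun i1 i2 _ => x i1 * y i2). *)
Definition antisym (m : 'I_3 -> 'I_3 -> 'I_3 -> F) : F :=
  \sum_(s : 'S_3) (-1) ^+ s * m (s 0) (s 1) (s (1 + 1)).

End Lines.

(* Main.v *)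
(** For each colour let [form] be the bilinear form u1 v1 + u2 v2, u1 v1 - u2 v2
    or u1 v2 + u2 v1.  A point P lies on the altitude of that colour from Q to
    the line RS exactly when form (P - Q) (S - R) = 0.  The altitudes of a
    triangle thus give three linear equations in P that sum to zero, and any two
    of them have determinant [x_1 y_2]^- up to sign, which is nonzero for
    non-collinear points.  So the equations have at most one solution, and the
    stated point is checked to satisfy them. *)
Require Import Defs.
From mathcomp Require Import all_boot all_order all_algebra.
From mathcomp Require Import perm ring.

Set Implicit Arguments.
Unset Strict Implicit.
Unset Printing Implicit Defensive.

Import GRing.Theory.
Local Open Scope ring_scope.

(** A permutation is determined by the image [j] of [i] and by what it induces on the remaining
    points. Injectivity suffices for bijectivity, since both sides have [n.+1]! elements. *)
Lemma big_lift_perm (V : nmodType) n (G : 'S_n.+1 -> V) (i : 'I_n.+1) :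
  \sum_s G s = \sum_j \sum_t G (lift_perm i j t).
Proof.
rewrite pair_big /= (reindex (fun p : 'I_n.+1 * 'S_n => lift_perm i p.1 p.2)) //.
apply: onW_bij; apply: inj_card_bij => [[j t] [k u] /= /permP e|]; last first.
  by rewrite card_prod card_ord !card_Sn factS.
have jk := e i; rewrite !lift_perm_id in jk; rewrite jk in e *.
congr (_, _); apply/permP => l; apply: (@lift_inj _ k).
by have := e (lift i l); rewrite !lift_perm_lift.
Qed.

Lemma ord3_ind (Q : 'I_3 -> Prop) : Q 0 -> Q 1 -> Q (1 + 1) -> forall i, Q i.
Proof.
move=> Q0 Q1 Q2 [[|[|[|//]]] h].
- by have -> : Ordinal h = 0 by exact: val_inj.
- by have -> : Ordinal h = 1 by exact: val_inj.
- by have -> : Ordinal h = 1 + 1 by exact: val_inj.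
Qed.

Lemma antisymE (F : fieldType) (m : 'I_3 -> 'I_3 -> 'I_3 -> F) :
  antisym m = m 0 1 (1 + 1) - m 0 (1 + 1) 1 + m 1 (1 + 1) 0 - m 1 0 (1 + 1)
    + m (1 + 1) 0 1 - m (1 + 1) 1 0.
Proof.
(* Nested lifts yield ordinals that are equal only up to their proofs; passing to natural numbers
   lets them be compared by computation. *)
have [M mE] : exists M : nat -> nat -> nat -> F, forall i j k, m i j k = M i j k.
  by exists (fun i j k => m (inord i) (inord j) (inord k)) => i j k; rewrite !inord_val.
rewrite /antisym (big_lift_perm _ 0).
under eq_bigr do rewrite (big_lift_perm _ 0).
under eq_bigr do under eq_bigr do rewrite (big_lift_perm _ 0).
have S0 (G : {perm 'I_0} -> F) : \sum_t G t = G (perm_one 'I_0).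
  rewrite (bigD1 (perm_one 'I_0)) /= ?big1 ?addr0 // => t /eqP[]; apply/permP => -[] //.
rewrite !big_ord_recl !big_ord0 !S0 /= !mE.
have -> : (1 + 1 : 'I_3) = lift 0 (lift 0 0) by exact: val_inj.
have -> : (1 : 'I_3) = lift 0 0 by exact: val_inj.
by rewrite !(lift_perm_lift, lift_perm_id) !odd_lift_perm odd_perm1 /=; ring.
Qed.

Definition form (F : fieldType) (col : colour) (u v : F * F) : F :=
  match col with
  | Blue => u.1 * v.1 + u.2 * v.2
  | Red => u.1 * v.1 - u.2 * v.2
  | Green => u.1 * v.2 + u.2 * v.1
  end.

(** This is Cramer's rule: each coordinate of [u] times the determinant is a combination of the two
    vanishing values, with entries of [v] and [w], up to sign, as coefficients. *)
Lemma form_nondegenerate (F : fieldType) col (u v w : F * F) :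
  form col u v = 0 -> form col u w = 0 -> v.1 * w.2 - v.2 * w.1 != 0 ->
  u = (0, 0).
Proof.
case: u v w => [u1 u2] [v1 v2] [w1 w2] /= ev ew d0.
have ez (k l z : F) :
    z = k * form col (u1, u2) (v1, v2) + l * form col (u1, u2) (w1, w2) -> z = 0.
  by rewrite ev ew !mulr0 addr0.
case: col ez {ev ew} => ez; congr (_, _); apply: (mulIf d0);
  rewrite mul0r; rewrite /form /= in ez.
- by apply: (ez w2 (- v2)); ring.
- by apply: (ez (- w1) v1); ring.
- by apply: (ez w2 (- v2)); ring.
- by apply: (ez w1 (- v1)); ring.
- by apply: (ez (- w1) v1); ring.
- by apply: (ez w2 (- v2)); ring.
Qed.

Section Lines.
Variable F : fieldType.
Implicit Types P Q R S : point F.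

Lemma neq_pointP P Q : P != Q -> (P.2 - Q.2 != 0) || (Q.1 - P.1 != 0).
Proof.
case: P Q => [p1 p2] [q1 q2] /=.
by rewrite !subr_eq0 (eq_sym q1) -negb_and andbC.
Qed.

Lemma line_throughE P Q (PQ : P != Q) :
  line_through P Q = mk_line (P.1 * Q.2 - P.2 * Q.1) (neq_pointP PQ).
Proof.
apply/esym/eqP; rewrite -line_through_unique // !on_lineE /cfa /cfb /cfc /=.
by apply/andP; split; apply/eqP; ring.
Qed.

Lemma on_line_through P Q S : P != Q ->
  on_line S (line_through P Q) =
  ((P.2 - Q.2) * S.1 + (Q.1 - P.1) * S.2 + (P.1 * Q.2 - P.2 * Q.1) == 0).
Proof. by move=> PQ; rewrite (line_throughE PQ) on_lineE. Qed.

Lemma on_altitude col P Q R S : R != S ->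
  on_line P (altitude col Q (line_through R S)) =
  (form col (P.1 - Q.1, P.2 - Q.2) (S.1 - R.1, S.2 - R.2) == 0).
Proof.
move=> RS; have h := neq_pointP RS.
(* The pair [(u, v)] is the normal of the altitude: [du] reads it off the form, and [dv] is its
   perpendicularity to the normal of [RS]. *)
have [u [v [uv du dv]]] : exists u v, [/\ (u != 0) || (v != 0),
    (forall p q, form col (p, q) (S.1 - R.1, S.2 - R.2) = u * p + v * q) &
    match col with
    | Blue => u * (R.2 - S.2) + v * (S.1 - R.1) = 0
    | Red => u * (R.2 - S.2) - v * (S.1 - R.1) = 0
    | Green => u * (S.1 - R.1) + v * (R.2 - S.2) = 0
    end].
  have h' : (S.1 - R.1 != 0) || (S.2 - R.2 != 0).
    by rewrite orbC -opprB oppr_eq0.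
  case: col; rewrite /form /=.
  - by exists (S.1 - R.1), (S.2 - R.2); split=> // *; ring.
  - exists (S.1 - R.1), (- (S.2 - R.2)); rewrite oppr_eq0.
    by split=> // *; ring.
  - by exists (S.2 - R.2), (S.1 - R.1); rewrite orbC; split=> // *; ring.
have <- : mk_line (- (u * Q.1 + v * Q.2)) uv = altitude col Q (line_through R S).
  apply/eqP; rewrite -altitude_unique (line_throughE RS) on_lineE perpendicularE.
  rewrite /cfa /cfb /cfc /= subrr eqxx /=.
  by case: col dv {du} => ->; rewrite eqxx.
by rewrite on_lineE du /cfa /cfb /cfc /=; congr (_ == 0); ring.
Qed.

End Lines.

Section Triangle.
Variables (F : fieldType) (A : 'I_3 -> point F).
Hypotheses (injA : injective A) (ncA : ~ collinear A).

(** The bracket is the equation of the line through [A 0] and [A 1] evaluated at the third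
    vertex. *)
Lemma antisym_neq0 : antisym (fun i j _ => (A i).1 * (A j).2) != 0.
Proof.
apply/negP => /eqP; rewrite antisymE => D0; apply: ncA.
have A01 : A 0 != A 1 by rewrite (inj_eq injA).
exists (line_through (A 0) (A 1)).
have /andP[h0 h1] := line_throughP (A 0) (A 1).
apply: ord3_ind => //; rewrite on_line_through //; apply/eqP; rewrite -[RHS]D0; ring.
Qed.

Lemma triangle_altitudes_meet_at col (O : point F) :
  form col (O.1 - (A 0).1, O.2 - (A 0).2)
    ((A (1 + 1)).1 - (A 1).1, (A (1 + 1)).2 - (A 1).2) = 0 ->
  form col (O.1 - (A 1).1, O.2 - (A 1).2)
    ((A 0).1 - (A (1 + 1)).1, (A 0).2 - (A (1 + 1)).2) = 0 ->
  meet_at (triangle_altitude col A) O.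
Proof.
have e0 : 0 + 1 = 1 :> 'I_3 by exact: val_inj.
have e2 : 1 + 1 + 1 = 0 :> 'I_3 by exact: val_inj.
have altE P i : on_line P (triangle_altitude col A i) =
    (form col (P.1 - (A i).1, P.2 - (A i).2)
      ((A (i + 1 + 1)).1 - (A (i + 1)).1, (A (i + 1 + 1)).2 - (A (i + 1)).2) == 0).
  by apply: on_altitude; rewrite (inj_eq injA); elim/ord3_ind: i.
move=> O0 O1 P; split=> [PL|->{P}].
  (* Uniqueness: subtracting the equations of [P] and [O] eliminates the vertex, so [P - O] is
     orthogonal to two sides. *)
  have sub (Q : point F) v : form col (P.1 - Q.1, P.2 - Q.2) v = 0 ->
      form col (O.1 - Q.1, O.2 - Q.2) v = 0 ->
      form col (P.1 - O.1, P.2 - O.2) v = 0.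
    move=> PQ OQ; rewrite -[RHS](subrr 0) -{1}PQ -OQ.
    by case: (col); rewrite /form /=; ring.
  have := PL 1; have := PL 0; rewrite !altE e2 e0 => /eqP P0 /eqP P1.
  have : (P.1 - O.1, P.2 - O.2) = (0, 0).
    apply: form_nondegenerate (sub _ _ P0 O0) (sub _ _ P1 O1) _.
    apply: contraNneq antisym_neq0 => /= d0.
    by rewrite antisymE -d0; apply/eqP; ring.
  case=> /eqP + /eqP; rewrite !subr_eq0 => /eqP + /eqP.
  by case: (P) (O) => ? ? [? ?] /= -> ->.
apply: ord3_ind; rewrite altE ?e2 ?e0 ?O0 ?O1 //.
(* The third equation is minus the sum of the first two. *)
apply/eqP; apply: oppr_inj; rewrite oppr0 -[RHS](addr0 0) -{1}O0 -O1.
by case: (col); rewrite /form /=; ring.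
Qed.

End Triangle.

Theorem theorem12 (F : fieldType) (char_neq2 : 2%N \notin [pchar F])
    (x y : 'I_3 -> F) :
  let A : 'I_3 -> point F := fun i => (x i, y i) in
  let D := antisym (fun i1 i2 _ => x i1 * y i2) in
  injective A -> ~ collinear A ->
  [/\ meet_at (triangle_altitude Blue A)
        ((antisym (fun i1 i2 _ => x i1 * x i2 * y i2)
          + antisym (fun i1 i2 _ => y i1 * y i2 ^+ 2)) / D,
         (antisym (fun i1 i2 _ => x i1 * y i1 * y i2)
          + antisym (fun i1 i2 _ => x i1 ^+ 2 * x i2)) / D),
      meet_at (triangle_altitude Red A)
        ((antisym (fun i1 i2 _ => x i1 * x i2 * y i2)
          - antisym (fun i1 i2 _ => y i1 * y i2 ^+ 2)) / D,
         (antisym (fun i1 i2 _ => x i1 * y i1 * y i2)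
          - antisym (fun i1 i2 _ => x i1 ^+ 2 * x i2)) / D)
    & meet_at (triangle_altitude Green A)
        ((antisym (fun i1 i2 _ => x i1 ^+ 2 * y i2)
          + antisym (fun i1 i2 _ => x i1 * x i2 * y i1)) / D,
         (antisym (fun i1 i2 _ => x i1 * y i2 ^+ 2)
          - antisym (fun i1 i2 _ => x i1 * y i1 * y i2)) / D)].
Proof.
move=> A D injA ncA; have D0 : D != 0 by exact: (antisym_neq0 injA ncA).
have DE := antisymE (fun i j _ => x i * y j); rewrite -/D in DE.
split; apply: triangle_altitudes_meet_at => //; rewrite /form !antisymE /A /=.
(* With [D] expanded, clearing the denominator leaves polynomial identities in the six coordinates,
   two per colour. *)
all: rewrite DE in D0 *; field; exact: D0.
Qed.
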